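(* Let $\mathcal S\subset\mathbb H^1$ be an oriented $C^2$ surface with characteristic set $\Sigma_{\mathcal S}$. For every $g_0\in\mathcal S\setminus\Sigma_{\mathcal S}$, $$\lim_{\epsilon\to0^+}H^\epsilon_{\mathcal R}(g_0)=\mathcal H(g_0),$$ where $H^\epsilon_{\mathcal R}$ is the mean curvature of $\mathcal S$ in the Riemannian metric $g^\epsilon$ on $\mathbb H^1$ for which $\{X_1,X_2,\sqrt\epsilon\,T\}$ is orthonormal, and $\mathcal H$ is the $H$-mean curvature of $\mathcal S$.
   Context: $\mathbb H^1=\mathbb R^3$ with group law $(x,y,t)(x',y',t')=(x+x',y+y',t+t'+\frac12(xy'-x'y))$ and left-invariant fields $X_1=\partial_x-\frac y2\partial_t$, $X_2=\partial_y+\frac x2\partial_t$, $T=\partial_t$; $\langle\cdot,\cdot\rangle$ is the Riemannian metric making $\{X_1,X_2,T\}$ orthonormal, $\nabla$ its Levi-Civita connection. With $\boldsymbol N$ a non-unit normal to $\mathcal S$ for this metric, $p=\langle\boldsymbol N,X_1\rangle$, $q=\langle\boldsymbol N,X_2\rangle$, $W=\sqrt{p^2+q^2}$, $\Sigma_{\mathcal S}=\{W=0\}$; off $\Sigma_{\mathcal S}$, $\bar p=p/W$, $\bar q=q/W$, $\nu^H=\bar pX_1+\bar qX_2$, and $\mathcal H=-\langle\nabla_{\boldsymbol e}\boldsymbol e,\nu^H\rangle$ with $\boldsymbol e=\bar qX_1-\bar pX_2$. $H^\epsilon_{\mathcal R}$ is the sum of the principal curvatures, i.e. the $g^\epsilon$-divergence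 along $\mathcal S$ of the $g^\epsilon$-unit normal $\nu_\epsilon$ chosen on the same side of $\mathcal S$ as $\boldsymbol N$. *)

(* Defs.v *)
From HB Require Import structures.
From mathcomp Require Import all_boot all_order all_algebra.
From mathcomp Require Import all_classical all_reals all_analysis.
From mathcomp Require Import ring.
Import Order.TTheory GRing.Theory Num.Theory.
Import numFieldNormedType.Exports.

Set Implicit Arguments.
Unset Strict Implicit.
Unset Printing Implicit Defensive.

Local Open Scope classical_set_scope.
Local Open Scope ring_scope.

Section R3.
Context {R : realType}.

Definition vec3 (a b c : R) : 'rV[R]_3 := \row_(i < 3) [:: a; b; c]`_i.

Definition C1_on (U : set 'rV[R]_3) (f : 'rV[R]_3 -> R) : Prop :=
  forall x, U x ->
    differentiable f x /\ forall v, {for x, continuous (fun y => 'D_v f y)}.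

Definition C2_on (U : set 'rV[R]_3) (f : 'rV[R]_3 -> R) : Prop :=
  C1_on U f /\ forall v, C1_on U (fun y => 'D_v f y).

(* Embedded surfaces: locally, regular level sets of C^2 functions. *)
Definition C2_surface (S : set 'rV[R]_3) : Prop :=
  forall x, S x -> exists (U : set 'rV[R]_3) (phi : 'rV[R]_3 -> R),
    [/\ open U, U x, C2_on U phi,
        (forall y, U y -> exists v, 'D_v phi y != 0) &
        S `&` U = [set y | U y /\ phi y = 0]].

Definition curve_in (S : set 'rV[R]_3) (x v : 'rV[R]_3) : set (R -> 'rV[R]_3) :=
  [set gamma | [/\ gamma 0 = x, is_derive (0 : R) (1 : R) gamma v &
                   \forall t \near (0 : R), S (gamma t)]].

Definition tangent (S : set 'rV[R]_3) (x : 'rV[R]_3) : set 'rV[R]_3 :=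
  [set v | exists gamma, curve_in S x v gamma].

(* Derivative, in the tangent direction v, of a field Y that is only
   meaningful on S: the derivative of Y along any curve in S with velocity v
   at x. *)
Definition derive_along (S : set 'rV[R]_3) (Y : 'rV[R]_3 -> 'rV[R]_3)
    (x v : 'rV[R]_3) : 'rV[R]_3 :=
  derive1 (fun t : R => Y (xget (cst x) (curve_in S x v) t)) 0.

(* A Riemannian metric on R^3 is given by its Gram matrix in the coordinates
   (x, y, t), tangent vectors being row vectors of components. *)
Definition metric := 'rV[R]_3 -> 'M[R]_3.

Definition ip (G : metric) (x v w : 'rV[R]_3) : R := (v *m G x *m w^T) 0 0.

Definition frame_mx (Y1 Y2 Y3 : 'rV[R]_3 -> 'rV[R]_3) (x : 'rV[R]_3) : 'M[R]_3 :=
  \matrix_(i < 3) [:: Y1 x; Y2 x; Y3 x]`_i.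

(* The metric for which {Y1, Y2, Y3} is orthonormal: a vector v has components
   v F^-1 in the frame F. *)
Definition frame_metric (Y1 Y2 Y3 : 'rV[R]_3 -> 'rV[R]_3) : metric :=
  fun x => invmx (frame_mx Y1 Y2 Y3 x) *m (invmx (frame_mx Y1 Y2 Y3 x))^T.

Definition christoffel (G : metric) (x : 'rV[R]_3) (k i j : 'I_3) : R :=
  2^-1 * \sum_(l < 3) invmx (G x) k l *
    ('D_(delta_mx 0 i) (fun y => G y j l) x
     + 'D_(delta_mx 0 j) (fun y => G y i l) x
     - 'D_(delta_mx 0 l) (fun y => G y i j) x).

(* Levi-Civita covariant derivative nabla_v Y of a field Y along S. *)
Definition nabla (G : metric) (S : set 'rV[R]_3) (Y : 'rV[R]_3 -> 'rV[R]_3)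
    (x v : 'rV[R]_3) : 'rV[R]_3 :=
  derive_along S Y x v +
  \row_(k < 3) \sum_(i < 3) \sum_(j < 3)
     christoffel G x k i j * v 0 i * Y x 0 j.

Definition normal_vector (G : metric) (S : set 'rV[R]_3)
    (x n : 'rV[R]_3) : Prop :=
  forall v, tangent S x v -> ip G x n v = 0.

Definition tangent_onb (G : metric) (S : set 'rV[R]_3) (x : 'rV[R]_3) :
    set ('rV[R]_3 * 'rV[R]_3) :=
  [set b | [/\ tangent S x b.1, tangent S x b.2, ip G x b.1 b.1 = 1,
               ip G x b.2 b.2 = 1 & ip G x b.1 b.2 = 0]].

Definition surface_div (G : metric) (S : set 'rV[R]_3)
    (Y : 'rV[R]_3 -> 'rV[R]_3) (x : 'rV[R]_3) : R :=
  let b := xget (0, 0) (tangent_onb G S x) in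
  ip G x (nabla G S Y x b.1) b.1 + ip G x (nabla G S Y x b.2) b.2.

(* Group law of the Heisenberg group; indices 0, 1, 2 are x, y, t. *)
Definition hmul (g h : 'rV[R]_3) : 'rV[R]_3 :=
  vec3 (g 0 0 + h 0 0) (g 0 1 + h 0 1)
       (g 0 2 + h 0 2 + 2^-1 * (g 0 0 * h 0 1 - h 0 0 * g 0 1)).

Definition X1 (g : 'rV[R]_3) : 'rV[R]_3 := vec3 1 0 (- (g 0 1 / 2)).
Definition X2 (g : 'rV[R]_3) : 'rV[R]_3 := vec3 0 1 (g 0 0 / 2).
Definition XT (g : 'rV[R]_3) : 'rV[R]_3 := vec3 0 0 1.

Definition heis_metric : metric := frame_metric X1 X2 XT.

Definition heis_metric_eps (eps : R) : metric :=
  frame_metric X1 X2 (fun x => Num.sqrt eps *: XT x).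

(* An orientation of S, given by a (non-unit) normal for heis_metric; only its
   continuity is required, since lengths are irrelevant below. *)
Definition orientation (S : set 'rV[R]_3) (N : 'rV[R]_3 -> 'rV[R]_3) : Prop :=
  {within S, continuous N} /\
  forall x, S x -> N x != 0 /\ normal_vector heis_metric S x (N x).

Section Horizontal.
Variable N : 'rV[R]_3 -> 'rV[R]_3.

Definition hp (x : 'rV[R]_3) : R := ip heis_metric x (N x) (X1 x).
Definition hq (x : 'rV[R]_3) : R := ip heis_metric x (N x) (X2 x).
Definition hW (x : 'rV[R]_3) : R := Num.sqrt (hp x ^+ 2 + hq x ^+ 2).
Definition hpbar (x : 'rV[R]_3) : R := hp x / hW x.
Definition hqbar (x : 'rV[R]_3) : R := hq x / hW x.

Definition horizontal_normal (x : 'rV[R]_3) : 'rV[R]_3 :=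
  hpbar x *: X1 x + hqbar x *: X2 x.
Definition horizontal_tangent (x : 'rV[R]_3) : 'rV[R]_3 :=
  hqbar x *: X1 x - hpbar x *: X2 x.
End Horizontal.

Definition characteristic_set (S : set 'rV[R]_3) (N : 'rV[R]_3 -> 'rV[R]_3) :
    set 'rV[R]_3 := [set x | S x /\ hW N x = 0].

Definition H_mean_curvature (S : set 'rV[R]_3) (N : 'rV[R]_3 -> 'rV[R]_3)
    (x : 'rV[R]_3) : R :=
  - ip heis_metric x
      (nabla heis_metric S (horizontal_tangent N) x (horizontal_tangent N x))
      (horizontal_normal N x).

(* As N is heis_metric-normal to S, a vector transverse to S points to the
   same side of S as N exactly when its heis_metric product with N is
   positive. *)
Definition unit_normal_set (G : metric) (S : set 'rV[R]_3)
    (N : 'rV[R]_3 -> 'rV[R]_3) (x : 'rV[R]_3) : set 'rV[R]_3 :=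
  [set n | [/\ normal_vector G S x n, ip G x n n = 1 &
               0 < ip heis_metric x n (N x)]].

Definition unit_normal (G : metric) (S : set 'rV[R]_3)
    (N : 'rV[R]_3 -> 'rV[R]_3) (x : 'rV[R]_3) : 'rV[R]_3 :=
  xget 0 (unit_normal_set G S N x).

Definition riem_mean_curvature (eps : R) (S : set 'rV[R]_3)
    (N : 'rV[R]_3 -> 'rV[R]_3) (x : 'rV[R]_3) : R :=
  surface_div (heis_metric_eps eps) S
    (unit_normal (heis_metric_eps eps) S N) x.

Lemma frame_metricP (Y1 Y2 Y3 : 'rV[R]_3 -> 'rV[R]_3) (x : 'rV[R]_3) :
  frame_mx Y1 Y2 Y3 x \in unitmx ->
  forall i j : 'I_3,
    ip (frame_metric Y1 Y2 Y3) x (row i (frame_mx Y1 Y2 Y3 x))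
       (row j (frame_mx Y1 Y2 Y3 x)) = (i == j)%:R.
Proof.
move=> Fu i j; rewrite /ip /frame_metric !rowE trmx_mul !mulmxA mulmxK //.
rewrite -(mulmxA (delta_mx 0 i)) -trmx_mul mulmxV // trmx1 mulmx1 trmx_delta.
by rewrite mul_delta_mx_cond mulmxnE mxE !eqxx /=.
Qed.

Lemma heis_frame_unit (eps : R) (x : 'rV[R]_3) : 0 < eps ->
  frame_mx X1 X2 (fun y => Num.sqrt eps *: XT y) x \in unitmx.
Proof.
move=> e0; rewrite unitmxE -det_tr det_trig.
  rewrite !big_ord_recl big_ord0 !mxE /=.
  by rewrite !mul1r !mulr1 unitfE gt_eqF ?sqrtr_gt0.
by apply/is_trig_mxP => -[[|[|[|//]]] ?] [[|[|[|//]]] ?] //= _; rewrite !mxE /= ?mulr0.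
Qed.

(* The next two lemmas say that the connection with these symbols is
   torsion-free and metric, i.e. the Levi-Civita one. *)
Lemma christoffel_sym (G : metric) (x : 'rV[R]_3) (k i j : 'I_3) :
  (forall y, (G y)^T = G y) -> christoffel G x k i j = christoffel G x k j i.
Proof.
move=> Gs; rewrite /christoffel; congr (_ * _); apply: eq_bigr => l _.
have -> : (fun y => G y i j) = (fun y => G y j i).
  by apply/funext => y; rewrite -{1}Gs mxE.
by ring.
Qed.

Lemma christoffel_metric (G : metric) (x : 'rV[R]_3) (i j k : 'I_3) :
  (forall y, (G y)^T = G y) -> G x \in unitmx ->
  'D_(delta_mx 0 i) (fun y => G y j k) x =
    \sum_l christoffel G x l i j * G x l k +
    \sum_l christoffel G x l i k * G x j l.
Proof.
move=> Gs Gu.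
have GsE a b : (fun y => G y a b) = (fun y => G y b a).
  by apply/funext => y; rewrite -{1}Gs mxE.
have lower a b c : \sum_l christoffel G x l a b * G x c l =
    2^-1 * ('D_(delta_mx 0 a) (fun y => G y b c) x
     + 'D_(delta_mx 0 b) (fun y => G y a c) x
     - 'D_(delta_mx 0 c) (fun y => G y a b) x).
  set f := fun c => 'D_(delta_mx 0 a) (fun y => G y b c) x
     + 'D_(delta_mx 0 b) (fun y => G y a c) x
     - 'D_(delta_mx 0 c) (fun y => G y a b) x.
  have -> : \sum_l christoffel G x l a b * G x c l =
      2^-1 * (G x *m (invmx (G x) *m \col_l f l)) c 0.
    rewrite mxE mulr_sumr; apply: eq_bigr => l _.
    rewrite mxE /christoffel -mulrA; congr (_ * _).
    by rewrite mulrC; congr (_ * _); apply: eq_bigr => m _; rewrite mxE.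
  by rewrite mulmxA mulmxV // mul1mx mxE.
under eq_bigr => l _ do rewrite -(Gs x) mxE.
rewrite !lower (GsE k j); by field.
Qed.

(* The fields are left-invariant: they generate the right translations
   g |-> g * (t, 0, 0), and so on. *)
Lemma hmul_fields (g : 'rV[R]_3) (t : R) :
  [/\ hmul g (vec3 t 0 0) = g + t *: X1 g,
      hmul g (vec3 0 t 0) = g + t *: X2 g &
      hmul g (vec3 0 0 t) = g + t *: XT g].
Proof.
have E (h : 'rV[R]_3) (w : 'rV[R]_3) :
    h 0 0 = w 0 0 -> h 0 1 = w 0 1 -> h 0 2 = w 0 2 -> h = w.
  move=> h0 h1 h2; apply/rowP => -[[|[|[|//]]] i3].
  - by move: h0; congr (h _ _ = w _ _); apply/val_inj.
  - by move: h1; congr (h _ _ = w _ _); apply/val_inj.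
  - by move: h2; congr (h _ _ = w _ _); apply/val_inj.
by split; apply: E; rewrite !mxE /= ?mxE /=; ring.
Qed.

End R3.

(* Main.v *)
(* Let phi be a local defining function of S, with sign chosen so that its
   gradient is on the side of N, and p, q, r = X1 phi, X2 phi, T phi. The
   g^eps-unit normal is nu = (p X1 + q X2 + eps r T) / L with
   L = sqrt (p^2 + q^2 + eps r^2). Completing a tangent orthonormal basis by nu
   turns the surface divergence of nu into a full trace; the Christoffel terms
   and the nu-nu entry drop out, because the lowered symbols are
   Gamma(v, u, w) = (theta(u) dtheta(v, w) + theta(v) dtheta(u, w)) / eps, so
     H^eps = X1 (p / L) + X2 (q / L) + eps T (r / L).
   At eps = 0 this is X1 pbar + X2 qbar, which is
   qbar e(pbar) - pbar e(qbar) = - <nabla_e e, nu^H> since pbar^2 + qbar^2 = 1.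
   The vectors tangent to S, defined as velocities of curves, are the kernel of
   d phi by a hands-on implicit function argument. *)

Require Import Defs.
From mathcomp Require Import all_boot all_order all_algebra.
From mathcomp Require Import all_classical all_reals all_analysis.
From mathcomp Require Import ring lra.
Import Order.TTheory GRing.Theory Num.Theory.
Import numFieldNormedType.Exports.
Local Open Scope classical_set_scope.
Local Open Scope ring_scope.

(** * Coordinates and the metrics *)

Section Coordinates.
Set Implicit Arguments.
Unset Strict Implicit.
Context {R : realType}.
Implicit Types (x v w : 'rV[R]_3) (eps : R).

Lemma ord3P (P : 'I_3 -> Prop) : P 0 -> P 1 -> P 2 -> forall i, P i.
Proof.
move=> P0 P1 P2 [[|[|[|//]]] i3].
- by move: P0; congr P; apply/val_inj.
- by move: P1; congr P; apply/val_inj.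
- by move: P2; congr P; apply/val_inj.
Qed.

Lemma sum_ord3 (V : nmodType) (F : 'I_3 -> V) :
  \sum_(i < 3) F i = F 0 + F 1 + F 2.
Proof.
rewrite !big_ord_recl big_ord0 addr0 addrA.
by congr (_ + _ + _); congr F; apply/val_inj.
Qed.

Lemma row3P v w : v 0 0 = w 0 0 -> v 0 1 = w 0 1 -> v 0 2 = w 0 2 -> v = w.
Proof. by move=> *; apply/rowP; apply: ord3P. Qed.

Lemma vec3E (a b c : R) :
  (vec3 a b c 0 0 = a) * (vec3 a b c 0 1 = b) * (vec3 a b c 0 2 = c).
Proof. by rewrite /vec3 !mxE. Qed.

Lemma delta3E :
  ((delta_mx 0 0 : 'rV[R]_3) = vec3 1 0 0) *
  ((delta_mx 0 1 : 'rV[R]_3) = vec3 0 1 0) *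
  ((delta_mx 0 2 : 'rV[R]_3) = vec3 0 0 1).
Proof. by do !split; apply: row3P; rewrite !mxE. Qed.

(* The contact form: the XT-component of v in the frame X1, X2, XT. *)
Definition theta x v : R := v 0 2 + x 0 1 / 2 * v 0 0 - x 0 0 / 2 * v 0 1.

(** In the orthonormal frame [X1], [X2], [sqrt eps * XT] the vector [v] has components [v 0 0],
    [v 0 1] and [theta x v / sqrt eps]; in the product the root occurs squared. *)
Lemma ip_heis_eps eps x v w : 0 < eps ->
  ip (heis_metric_eps eps) x v w =
    v 0 0 * w 0 0 + v 0 1 * w 0 1 + eps^-1 * (theta x v * theta x w).
Proof.
move=> e0; have se0 : Num.sqrt eps != 0 by rewrite gt_eqF ?sqrtr_gt0.
have compE u : u *m invmx (frame_mx X1 X2 (fun y => Num.sqrt eps *: XT y) x) =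
    vec3 (u 0 0) (u 0 1) (theta x u / Num.sqrt eps).
  rewrite -[RHS](mulmxK (heis_frame_unit x e0)); congr (_ *m _).
  by apply: row3P; rewrite mxE sum_ord3 !mxE /= /theta; field.
rewrite /ip /heis_metric_eps /frame_metric mulmxA -mulmxA -trmx_mul !compE.
rewrite mxE sum_ord3 ![_^T _ _]mxE !vec3E; congr (_ + _).
by rewrite mulrACA -invfM -expr2 sqr_sqrtr ?ltW // [RHS]mulrC.
Qed.

Lemma heis_metricE : heis_metric = heis_metric_eps (1 : R).
Proof.
rewrite /heis_metric /heis_metric_eps sqrtr1; congr frame_metric.
by apply/funext => x; rewrite scale1r.
Qed.

Lemma ip_heis x v w :
  ip heis_metric x v w = v 0 0 * w 0 0 + v 0 1 * w 0 1 + theta x v * theta x w.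
Proof. by rewrite heis_metricE ip_heis_eps // invr1 mul1r. Qed.

(** The derivative along [v] of [theta] evaluated on the constant vector [w]. By antisymmetry it is
    half of the exterior derivative [v (theta w) - w (theta v)]. *)
Definition dtheta v w : R := (v 0 1 * w 0 0 - v 0 0 * w 0 1) / 2.

Lemma heis_eps_gram eps x (i j : 'I_3) : 0 < eps ->
  heis_metric_eps eps x i j =
    ((i == j) && (i != 2))%:R +
    eps^-1 * (theta x (delta_mx 0 i) * theta x (delta_mx 0 j)).
Proof.
move=> e0; have -> : heis_metric_eps eps x i j =
    ip (heis_metric_eps eps) x (delta_mx 0 i) (delta_mx 0 j).
  by rewrite /ip -rowE -[LHS](mxE matrix_key) trmx_delta -colE !mxE.
rewrite ip_heis_eps //; congr (_ + _).
by move: i j; apply: ord3P; apply: ord3P; rewrite !delta3E !vec3E /=; ring.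
Qed.

Lemma heis_eps_sym eps x : (heis_metric_eps eps x)^T = heis_metric_eps eps x.
Proof. by rewrite /heis_metric_eps /frame_metric trmx_mul trmxK. Qed.

Lemma heis_eps_unit eps x : 0 < eps -> heis_metric_eps eps x \in unitmx.
Proof.
move=> e0; rewrite /heis_metric_eps /frame_metric unitmx_mul unitmx_tr.
by rewrite !unitmx_inv !heis_frame_unit.
Qed.

Lemma is_derive_coord x v (i : 'I_3) :
  is_derive x v (fun y : 'rV[R]_3 => y 0 i) (v 0 i).
Proof.
have idx : derivable (fun y : 'rV[R]_3 => y) x v by exact: derivable_id.
have dx : derivable (fun y : 'rV[R]_3 => y 0 i) x v.
  exact: (derivable_mxP _ _ _).1.
apply: DeriveDef => //.
by rewrite -[in RHS](derive_id x v) derive_mx // mxE.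
Qed.

Lemma is_derive_theta x v w :
  is_derive x v (fun y => theta y w) (dtheta v w).
Proof.
have d0 := is_derive_coord x v 0; have d1 := is_derive_coord x v 1.
rewrite /theta /dtheta; apply: is_derive_eq; rewrite /GRing.scale /=; by field.
Qed.
End Coordinates.

(** * The connection *)

Section Connection.
Set Implicit Arguments.
Unset Strict Implicit.
Context {R : realType}.
Implicit Types (x v w u : 'rV[R]_3) (eps : R).

(** The product of [nabla_v u] with [w] when [u] has constant coordinates. *)
Definition heis_christoffel_lower eps x v u w : R :=
  eps^-1 * (theta x u * dtheta v w + theta x v * dtheta u w).

Lemma derive_heis_eps_gram eps x v (i j : 'I_3) : 0 < eps ->
  'D_v (fun y => heis_metric_eps eps y i j) x =
    eps^-1 * (dtheta v (delta_mx 0 i) * theta x (delta_mx 0 j) +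
              theta x (delta_mx 0 i) * dtheta v (delta_mx 0 j)).
Proof.
move=> e0; under eq_fun => y do rewrite heis_eps_gram //.
have di := is_derive_theta x v (delta_mx 0 i).
have dj := is_derive_theta x v (delta_mx 0 j).
apply: derive_val; apply: is_derive_eq; rewrite /GRing.scale /=; ring.
Qed.

(** Differentiating the Gram matrix gives six terms. The two that carry [theta] of the index [l]
    cancel by antisymmetry of [dtheta]; the other four agree in pairs, which absorbs the factor
    1/2. *)
Lemma heis_eps_christoffel eps x (k i j : 'I_3) : 0 < eps ->
  christoffel (heis_metric_eps eps) x k i j =
  \sum_(l < 3) invmx (heis_metric_eps eps x) k l *
    heis_christoffel_lower eps x (delta_mx 0 i) (delta_mx 0 j) (delta_mx 0 l).
Proof.
move=> e0; rewrite /christoffel mulr_sumr; apply: eq_bigr => l _.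
rewrite mulrCA; congr (_ * _); rewrite !derive_heis_eps_gram //.
rewrite /heis_christoffel_lower /dtheta; by field; rewrite gt_eqF.
Qed.

(** Pairing with the metric cancels the inverse Gram matrix contained in the symbols, so that only
    their lowered form survives. *)
Lemma ip_nabla_heis_eps eps (S : set 'rV[R]_3) (Y : 'rV[R]_3 -> 'rV[R]_3)
    x v w : 0 < eps ->
  ip (heis_metric_eps eps) x (nabla (heis_metric_eps eps) S Y x v) w =
  ip (heis_metric_eps eps) x (derive_along S Y x v) w +
  heis_christoffel_lower eps x v (Y x) w.
Proof.
move=> e0; rewrite {1}/ip /nabla !mulmxDl mxE; congr (_ + _).
set G := heis_metric_eps eps.
pose L := \row_(l < 3) \sum_(i < 3) \sum_(j < 3)
  heis_christoffel_lower eps x (delta_mx 0 i) (delta_mx 0 j) (delta_mx 0 l)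
  * v 0 i * Y x 0 j.
(* The inverse Gram matrix acts on columns in [christoffel] and on the row [L] here; its symmetry
   reconciles the two. *)
rewrite (_ : \row_k _ = L *m invmx (G x)); last first.
  apply/rowP => k; rewrite [LHS]mxE -[invmx (G x)]trmxK trmx_inv heis_eps_sym.
  rewrite [RHS]mxE.
  under eq_bigr => i _ do under eq_bigr => j _ do
    rewrite heis_eps_christoffel // -mulrA mulr_suml.
  under eq_bigr => i _ do rewrite exchange_big.
  rewrite exchange_big; apply: eq_bigr => l _ /=.
  rewrite [L _ _]mxE [_^T _ _]mxE mulr_suml; apply: eq_bigr => i _.
  rewrite mulr_suml; apply: eq_bigr => j _; ring.
rewrite mulmxKV ?heis_eps_unit // mxE sum_ord3 ![_^T _ _]mxE.
rewrite ![L _ _]mxE !sum_ord3 !delta3E /heis_christoffel_lower /theta /dtheta.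
rewrite !vec3E; field; by rewrite gt_eqF.
Qed.

(* For a G-orthonormal basis with rows b_i, the sum of the b_i^T b_i is the
   inverse of G. *)
Lemma sum_bilinear_onb n (G C B : 'M[R]_n) : G \in unitmx ->
  B *m G *m B^T = 1%:M -> \tr (B *m C *m B^T) = \tr (C *m invmx G).
Proof.
move=> Gu BGB; rewrite -mulmxA mxtrace_mulC -mulmxA; congr (\tr (C *m _)).
have : B^T *m (B *m G) = 1%:M by apply: mulmx1C.
by rewrite mulmxA => /(congr1 (mulmx^~ (invmx G))) /=; rewrite mulmxK // mul1mx.
Qed.
End Connection.

(** * Tangent vectors *)

Section Curves.
Set Implicit Arguments.
Unset Strict Implicit.
Context {R : realType}.
Implicit Types (x v w : 'rV[R]_3) (S U : set 'rV[R]_3) (gamma : R -> 'rV[R]_3).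

Lemma is_derive_comp_curve (f : 'rV[R]_3 -> R) gamma v :
  differentiable f (gamma 0) -> is_derive (0 : R) (1 : R) gamma v ->
  is_derive (0 : R) (1 : R) (f \o gamma) ('D_v f (gamma 0)).
Proof.
move=> df [dg gv]; have dg' := (derivable1_diffP _ _).1 dg.
have dfg := differentiable_comp dg' df.
apply: DeriveDef; first exact/derivable1_diffP.
by rewrite deriveE // diff_comp //= -gv [in RHS]deriveE // deriveE.
Qed.

Lemma curve_near gamma v (P : set 'rV[R]_3) :
  is_derive (0 : R) (1 : R) gamma v ->
  (\forall y \near gamma 0, P y) -> \forall t \near (0 : R), P (gamma t).
Proof.
move=> [dg _] nP; have /differentiable_continuous := (derivable1_diffP _ _).1 dg.
exact.
Qed.

Lemma tangent_ker S x v (phi : 'rV[R]_3 -> R) :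
  differentiable phi x -> (\forall y \near x, S y -> phi y = 0) ->
  tangent S x v -> 'D_v phi x = 0.
Proof.
move=> dphi S0 [gamma [g0 dg Sg]]; move: dphi S0; rewrite -g0 => dphi S0.
have [_ <-] := is_derive_comp_curve dphi dg.
rewrite (@near_eq_derive _ _ _ _ (cst 0)) ?derive_cst //.
have Z := curve_near dg S0.
by near=> t; apply: (near Z t) => //; near: t.
Unshelve. all: by end_near. Qed.

(** The curve picked by [xget] stays in [S] near time 0, so [Y] may be replaced along it by the
    extension [Z]; the chain rule then leaves nothing of the curve but its velocity. *)
Lemma derive_alongE S x v (Y Z : 'rV[R]_3 -> 'rV[R]_3) :
  (\forall y \near x, S y -> Y y = Z y) ->
  (forall i, differentiable (fun y => Z y 0 i) x) ->
  tangent S x v -> derive_along S Y x v = \row_i 'D_v (fun y => Z y 0 i) x.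
Proof.
move=> YZ dZ tv; rewrite /derive_along.
have /(@xgetPex _ (cst x)) : exists gamma, curve_in S x v gamma by [].
set gamma := xget _ _ => -[g0 dg Sg].
rewrite derive1E (@near_eq_derive _ _ _ _ (Z \o gamma)); last first.
  move: YZ; rewrite -g0 => /(curve_near dg) YZ.
  by near=> t; apply: (near YZ t) => //; near: t.
have di i : is_derive (0 : R) (1 : R) (fun t => Z (gamma t) 0 i)
    ('D_v (fun y => Z y 0 i) x).
  by move: (dZ i); rewrite -g0 => /is_derive_comp_curve; apply.
rewrite derive_mx; last by apply/derivable_mxP => i j; rewrite ord1; case: (di j).
by apply/rowP => i; rewrite !mxE; case: (di i).
Unshelve. all: by end_near. Qed.

Lemma diff_bound (phi : 'rV[R]_3 -> R) x e : 0 < e -> differentiable phi x ->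
  exists2 d, 0 < d & forall h, `|h| < d ->
    `|phi (h + x) - phi x - 'D_h phi x| <= e * `|h|.
Proof.
move=> e0 dphi.
have /eqaddoP/(_ _ e0) := funext (diff_locallyx dphi).
rewrite nearE => /nbhs_norm0P [d d0 H].
exists d => // h hd; rewrite deriveE //.
by have := H _ hd; rewrite /= opprD addrA.
Qed.

End Curves.

(** * Tangent vectors of a regular level set *)

Section LevelSetTangent.
Set Implicit Arguments.
Unset Strict Implicit.
Context {R : realType}.
Implicit Types (x v w : 'rV[R]_3) (S U : set 'rV[R]_3).

Lemma derive_comb (phi : 'rV[R]_3 -> R) x (a b : R) v w : differentiable phi x ->
  'D_(a *: v + b *: w) phi x = a * 'D_v phi x + b * 'D_w phi x.
Proof. by move=> d; rewrite !deriveE // linearD !linearZ. Qed.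

Lemma is_deriveZl (k : R -> R) (t dk : R) v : is_derive t (1 : R) k dk ->
  is_derive t (1 : R) (fun u => k u *: v) (dk *: v).
Proof.
move=> [dk1 <-]; have dk' := (derivable1_diffP _ _).1 dk1.
apply: DeriveDef; first exact/derivable1_diffP/differentiableZl.
rewrite deriveE; last exact: differentiableZl.
by rewrite diffZl // -deriveE.
Qed.

(** To first order [phi (x + t v + s w)] equals [s]. With an error of at most [eta |t|], its sign
    changes between [s = - eta |t|] and [s = eta |t|], and the intermediate value theorem in [s]
    gives a root. *)
Lemma level_set_crossing U (phi : 'rV[R]_3 -> R) x v w eta :
  open U -> U x -> (forall y, U y -> differentiable phi y) ->
  phi x = 0 -> 'D_v phi x = 0 -> 'D_w phi x = 1 -> 0 < eta <= 1 ->
  \forall t \near (0 : R), exists s,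
    [/\ `|s| <= eta * `|t|, U (x + t *: v + s *: w)
      & phi (x + t *: v + s *: w) = 0].
Proof.
move=> oU Ux dphi phix dv dw /andP[eta0 eta1].
(* For [|s| <= eta |t|] and [eta <= 1] the displacement [t v + s w] has norm at most [K |t|], so a
   relative error of [eta / K] becomes [eta |t|]. The summand 1 keeps [K] positive. *)
pose K := `|v| + `|w| + 1.
have K0 : 0 < K by rewrite /K ltr_wpDl // addr_ge0.
have [d d0 Hd] : exists2 d, 0 < d & forall h, `|h| < d ->
    `|phi (h + x) - phi x - 'D_h phi x| <= (eta / K) * `|h|.
  by apply: diff_bound; [rewrite divr_gt0 | exact: dphi].
have [d' d'0 Hd'] : exists2 d', 0 < d' & forall h, `|h| < d' -> U (x + h).
  have /nbhs_normP[r r0 Hr] : nbhs x U by exact: open_nbhs_nbhs.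
  by exists r => // h hr; apply: Hr; rewrite /= opprD addrA subrr sub0r normrN.
have dd : 0 < Num.min d d' / K by rewrite divr_gt0 // lt_min d0.
near=> t.
have tK : `|t| * K < Num.min d d'.
  by rewrite -ltr_pdivlMr //; near: t; exact: nbhs0_lt.
move: tK; rewrite lt_min => /andP[td td'].
have hK s : `|s| <= eta * `|t| -> `|t *: v + s *: w| <= `|t| * K.
  move=> st; apply: le_trans (ler_normD _ _) _; rewrite !normrZ /K.
  have : `|s| * `|w| <= `|t| * `|w|.
    by apply: ler_wpM2r => //; apply: le_trans st _; apply: ler_piMl.
  have : 0 <= `|t| by []. lra.
have bd s : `|s| <= eta * `|t| ->
    `|phi (x + t *: v + s *: w) - s| <= eta * `|t|.
  move=> st; have /Hd : `|t *: v + s *: w| < d by apply: le_lt_trans (hK _ st) _.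
  rewrite phix subr0 derive_comb; last exact: dphi.
  rewrite dv dw mulr0 add0r mulr1 [_ + x]addrC addrA => /le_trans; apply.
  by rewrite mulrAC ler_pdivrMr // -mulrA ler_pM2l // hK.
have inU s : `|s| <= eta * `|t| -> U (x + t *: v + s *: w).
  by move=> st; rewrite -addrA; apply: Hd'; apply: le_lt_trans (hK _ st) _.
have a0 : 0 <= eta * `|t| by rewrite mulr_ge0 // ltW.
have [|//||s] := @IVT R (fun s => phi (x + t *: v + s *: w))
   (- (eta * `|t|)) (eta * `|t|) 0.
- by rewrite ge0_cp.
- apply: continuous_in_subspaceT => s; rewrite inE /= in_itv /= -ler_norml => st.
  apply: (@continuous_comp _ _ _ (fun s : R => x + t *: v + s *: w) phi).
    apply: continuousD; first exact: cvg_cst.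
    by apply: continuousZr_tmp.
  exact/differentiable_continuous/dphi/inU.
(* At the two endpoints the bound [|phi - s| <= eta |t|] gives [phi >= 0] and [phi <= 0]
   respectively. *)
- have := bd (eta * `|t|); rewrite ger0_norm // => /(_ (lexx _)).
  have := bd (- (eta * `|t|)); rewrite normrN ger0_norm // => /(_ (lexx _)).
  rewrite !ler_norml => b1 b2.
  by rewrite ge_min le_max; apply/andP; split; apply/orP; [left|right]; lra.
- by rewrite in_itv /= -ler_norml => st s0; exists s; split => //; exact: inU.
Unshelve. all: by end_near. Qed.

(* No continuity of the curve away from 0 is needed, so the implicit function
   is merely chosen, at each t, as an almost smallest root s of
   phi (x + t v + s w) = 0; this forces s(t) = o(t). *)
Lemma ker_tangent S U (phi : 'rV[R]_3 -> R) x v w :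
  open U -> U x -> (forall y, U y -> differentiable phi y) ->
  S `&` U = [set y | U y /\ phi y = 0] -> S x ->
  'D_v phi x = 0 -> 'D_w phi x != 0 -> tangent S x v.
Proof.
move=> oU Ux dphi SU Sx dv dw0.
have phix : phi x = 0 by have [] : [set y | U y /\ phi y = 0] x by rewrite -SU.
pose w1 := ('D_w phi x)^-1 *: w.
have dw : 'D_w1 phi x = 1.
  have dphix := dphi _ Ux.
  by rewrite deriveE // linearZ /= -deriveE // [_ *: _]mulVf.
pose Z t := [set s : R | S (x + t *: v + s *: w1)].
(* The infimum of [|s|] over the roots may not be attained. The slack [t ^+ 2] is positive for
   [t != 0], is [o(t)], and vanishes at [t = 0], where it forces the choice [s = 0]. *)
pose P t := [set s : R | Z t s /\ forall s', Z t s' -> `|s| <= `|s'| + t ^+ 2].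
have Pex t : Z t !=set0 -> exists s, P t s.
  case: (eqVneq t 0) => [-> _|t0 Zn].
    exists 0; split; first by rewrite /Z /= !scale0r !addr0.
    by move=> s' _; rewrite normr0 addr_ge0 // sqr_ge0.
  have infZ : has_inf [set `|s| | s in Z t].
    split; first by case: Zn => s Zs; exists `|s|, s.
    by exists 0 => _ [s _ <-].
  have t2 : 0 < t ^+ 2 by rewrite exprn_even_gt0.
  have [_ [s Zs <-] sm] := inf_adherent t2 infZ.
  exists s; split => // s' Zs'; apply: le_trans (ltW sm) _.
  by rewrite lerD2r; apply: ge_inf; [case: infZ | exists s'].
pose s t := xget 0 (P t).
have sE eta : 0 < eta <= 1 -> \forall t \near (0 : R),
    Z t (s t) /\ `|s t| <= eta * `|t| + t ^+ 2.
  move=> eta01; have := level_set_crossing oU Ux dphi phix dv dw eta01.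
  apply: filterS => t [s' [s't Us' phis']].
  have Zs' : Z t s'.
    by have [] : (S `&` U) (x + t *: v + s' *: w1) by rewrite SU.
  have [Zs H] : P t (s t) by apply: xgetPex; apply: Pex; exists s'.
  by split => //; apply: le_trans (H _ Zs') _; rewrite lerD2r.
have s0 : s 0 = 0.
  have /Pex/(xgetPex 0) : Z 0 !=set0 by exists 0; rewrite /Z /= !scale0r !addr0.
  case=> _ /(_ 0); rewrite /Z /= !scale0r !addr0 normr0 expr0n addr0 => /(_ Sx).
  by rewrite normr_le0 => /eqP.
have ds : is_derive (0 : R) (1 : R) s 0.
  have cs : h^-1 *: (s (h *: 1 + 0) - s 0) @[h --> 0^'] --> (0 : R).
    apply/cvgr0Pnorm_le => e e0.
    (* Then [|s h| / |h| <= eta + |h|], which is at most [e] once [|h| <= e / 2]. *)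
    pose eta := Num.min 1 (e / 2).
    have eta01 : 0 < eta <= 1 by rewrite /eta lt_min ltr01 divr_gt0 //= ge_min lexx.
    have etae : eta <= e / 2 by rewrite /eta ge_min lexx orbT.
    near=> h.
    have h0 : h != 0 by near: h; exact: nbhs_dnbhs_neq.
    rewrite s0 subr0 addr0 [h *: 1]mulr1 normrZ normfV ler_pdivrMl ?normr_gt0 //.
    have [_ sh] : Z h (s h) /\ `|s h| <= eta * `|h| + h ^+ 2.
      by near: h; exact/nbhs_dnbhs/sE.
    apply: le_trans sh _; rewrite -real_normK ?num_real // expr2 -mulrDl mulrC.
    apply: ler_wpM2l => //.
    have : `|h| <= e / 2.
      by near: h; apply: dnbhs0_le; rewrite divr_gt0.
    lra.
  apply: DeriveDef; first by apply/cvg_ex; exists 0.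
  exact: cvg_lim cs.
exists (fun t => x + t *: v + s t *: w1); split.
- by rewrite s0 !scale0r !addr0.
- have dv1 := is_deriveZl v (is_derive_id (0 : R) (1 : R)).
  have dw1 := is_deriveZl w1 ds.
  have dx : is_derive (0 : R) (1 : R) (cst x) 0 by exact: is_derive_cst.
  by have := is_deriveD (is_deriveD dx dv1) dw1; rewrite scale0r addr0 add0r scale1r.
- by apply: filterS (sE 1 _) => [t []|]; rewrite ?ltr01 ?lexx.
Unshelve. all: by end_near. Qed.
End LevelSetTangent.

(** * Conormals and unit normals *)

Section Conormal.
Set Implicit Arguments.
Unset Strict Implicit.
Context {R : realType}.
Implicit Types (x y v w n : 'rV[R]_3) (S U : set 'rV[R]_3).
Implicit Types (N : 'rV[R]_3 -> 'rV[R]_3) (p q r eps : R).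

(** The coordinates of [a X1 + b X2 + c XT] at [x]. *)
Definition frame_vec x (a b c : R) : 'rV[R]_3 :=
  vec3 a b (c - x 0 1 / 2 * a + x 0 0 / 2 * b).

Lemma theta_frame_vec x (a b c : R) : theta x (frame_vec x a b c) = c.
Proof. by rewrite /theta !vec3E; ring. Qed.

Definition frame_vecE := (fun x (a b c : R) =>
  (vec3E a b (c - x 0 1 / 2 * a + x 0 0 / 2 * b), theta_frame_vec x a b c)).

(* A covector in the coframe dual to X1, X2, XT. *)
Definition covec x p q r v : R := v 0 0 * p + v 0 1 * q + theta x v * r.

(** The covector is determined up to a positive factor: its kernel is the tangent space, and its
    sign is fixed by the side of [N]. *)
Definition is_conormal S N x p q r : Prop :=
  (forall v, tangent S x v <-> covec x p q r v = 0) /\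
  0 < covec x p q r (N x).

Lemma derive_coords (f : 'rV[R]_3 -> R) x v : differentiable f x ->
  'D_v f x = v 0 0 * 'D_(delta_mx 0 0) f x + v 0 1 * 'D_(delta_mx 0 1) f x +
             v 0 2 * 'D_(delta_mx 0 2) f x.
Proof.
move=> df; rewrite !deriveE //.
rewrite {1}(row_sum_delta v) linear_sum sum_ord3.
by rewrite !linearZ.
Qed.

Lemma heis_normal_not_tangent S x n : n != 0 ->
  normal_vector heis_metric S x n -> ~ tangent S x n.
Proof.
move=> n0 nn /nn; rewrite ip_heis -!expr2 => e.
have [e0 e1 e2] : [/\ n 0 0 = 0, n 0 1 = 0 & theta x n = 0].
  have := sqr_ge0 (n 0 0); have := sqr_ge0 (n 0 1).
  have := sqr_ge0 (theta x n) => h2 h1 h0.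
  split; apply/eqP; rewrite -sqrf_eq0; apply/eqP; lra.
move: e2; rewrite /theta e0 e1 !mulr0 addr0 subr0 => e2.
by move/eqP: n0; apply; apply: row3P; rewrite !mxE.
Qed.

(** The differential of a local defining function, with its sign adjusted to [N]. It gives
    coefficients that are differentiable off [S] too, whereas [N] is only continuous on [S]. *)
Lemma local_conormal S N x : C2_surface S -> orientation S N -> S x ->
  exists p q r : 'rV[R]_3 -> R,
    [/\ differentiable p x, differentiable q x, differentiable r x &
        \forall y \near x, S y -> is_conormal S N y (p y) (q y) (r y)].
Proof.
move=> hS [cN hN] Sx; have [U [phi [oU Ux [C1 C2] reg SU]]] := hS _ Sx.
have dphi y : U y -> differentiable phi y by move=> /C1[].
have tanE y : U y -> S y -> forall v, tangent S y v <-> 'D_v phi y = 0.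
  move=> Uy Sy v; split.
    apply: tangent_ker; first exact: dphi.
    have : \forall z \near y, U z by exact: open_nbhs_nbhs.
    apply: filterS => z Uz Sz.
    by have [] : [set y | U y /\ phi y = 0] z by rewrite -SU.
  by have [w dw] := reg _ Uy => dv; apply: (ker_tangent oU Uy dphi SU Sy dv dw).
have DN0 y : U y -> S y -> 'D_(N y) phi y != 0.
  move=> Uy Sy; apply/eqP => /(tanE _ Uy Sy).
  by have [Ny0 nN] := hN _ Sy; exact: heis_normal_not_tangent.
pose c := Num.sg ('D_(N x) phi x).
have c0 : c != 0 by rewrite sgr_eq0 DN0.
have pos : \forall y \near x, S y -> 0 < c * 'D_(N y) phi y.
  have Ni i : (fun y => N y 0 i) y @[y --> within S (nbhs x)] --> N x 0 i.
    have cNx : N y @[y --> within S (nbhs x)] --> N x.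
      by move/subspace_continuousP : cN; apply.
    apply: (cvg_comp N (fun z : 'rV[R]_3 => z 0 i) cNx).
    exact: (@coord_continuous R 1 3 0 i (N x)).
  have Di i : 'D_(delta_mx 0 i) phi y @[y --> within S (nbhs x)]
      --> 'D_(delta_mx 0 i) phi x.
    apply: cvg_within_filter; have [_] := C1 _ Ux; exact.
  (* The direction [N y] moves with [y], while C^2 regularity speaks of fixed directions; expanding
     in partial derivatives reduces continuity to that of the coordinates of [N] and of the
     partials. *)
  pose DN y := N y 0 0 * 'D_(delta_mx 0 0) phi y +
    N y 0 1 * 'D_(delta_mx 0 1) phi y + N y 0 2 * 'D_(delta_mx 0 2) phi y.
  have cv : c * DN y @[y --> within S (nbhs x)] --> `|'D_(N x) phi x|.
    rewrite normrEsg -/c (derive_coords _ (dphi _ Ux)).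
    apply: cvgM; first exact: cvg_cst.
    by apply: cvgD; [apply: cvgD|]; apply: cvgM.
  have : \forall y \near within S (nbhs x), 0 < c * DN y.
    by apply: (cvgr_gt _ cv); rewrite normr_gt0 DN0.
  rewrite near_withinE.
  have : \forall z \near x, U z by exact: open_nbhs_nbhs.
  apply: filterS2 => y Uy H Sy; have := H Sy.
  by rewrite (derive_coords (N y) (dphi _ Uy)).
pose D i y := 'D_(delta_mx 0 i) phi y.
have dD i : differentiable (D i) x by have [] := C2 (delta_mx 0 i) _ Ux.
have dx i : differentiable (fun y : 'rV[R]_3 => y 0 i) x.
  exact: differentiable_coord.
(* The coefficients are [X1 phi], [X2 phi] and [XT phi], each times the sign [c]. *)
exists (fun y => c * (D 0 y - y 0 1 / 2 * D 2 y)).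
exists (fun y => c * (D 1 y + y 0 0 / 2 * D 2 y)), (fun y => c * D 2 y).
split.
- by apply: differentiableM => //; apply: differentiableB => //;
    do 2?apply: differentiableM.
- by apply: differentiableM => //; apply: differentiableD => //;
    do 2?apply: differentiableM.
- exact: differentiableM.
have : \forall z \near x, U z by exact: open_nbhs_nbhs.
apply: filterS2 pos => y pos Uy Sy.
have cE v : covec y (c * (D 0 y - y 0 1 / 2 * D 2 y))
    (c * (D 1 y + y 0 0 / 2 * D 2 y)) (c * D 2 y) v = c * 'D_v phi y.
  rewrite derive_coords; last exact: dphi.
  by rewrite /covec /theta /D; ring.
split=> [v|]; rewrite cE; last exact: pos.
rewrite tanE //; split=> [->|/eqP]; first by rewrite mulr0.
by rewrite mulf_eq0 (negPf c0) => /eqP.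
Qed.

Lemma conormal_sqr_gt0 S N x p q r eps : 0 < eps ->
  is_conormal S N x p q r -> 0 < p ^+ 2 + q ^+ 2 + eps * r ^+ 2.
Proof.
move=> e0 [_ pos]; rewrite lt_neqAle; apply/andP; split; last first.
  by rewrite addr_ge0 ?addr_ge0 ?sqr_ge0 // mulr_ge0 ?sqr_ge0 // ltW.
apply/eqP => E; have := sqr_ge0 p; have := sqr_ge0 q.
have := sqr_ge0 r; rewrite -(pmulr_rge0 _ e0) => hr hq hp.
have p0 : p = 0 by apply/eqP; rewrite -sqrf_eq0; apply/eqP; lra.
have q0 : q = 0 by apply/eqP; rewrite -sqrf_eq0; apply/eqP; lra.
have r0 : r = 0.
  have : eps * r ^+ 2 == 0 by apply/eqP; lra.
  by rewrite mulf_eq0 gt_eqF //= sqrf_eq0 => /eqP.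
by move: pos; rewrite /covec p0 q0 r0 !mulr0 !addr0 ltxx.
Qed.

(** Lowering the index turns [n] into the covector [(n 0 0, n 0 1, theta x n / eps)], which vanishes
    on the kernel of [(p, q, r)] and is therefore a multiple of it. *)
Lemma normal_conormal S N x n p q r eps : 0 < eps ->
  is_conormal S N x p q r -> normal_vector (heis_metric_eps eps) S x n ->
  exists k, [/\ n 0 0 = k * p, n 0 1 = k * q & theta x n = eps * (k * r)].
Proof.
move=> e0 cn nn; have D0 := conormal_sqr_gt0 ltr01 cn; rewrite mul1r in D0.
have H a b c : a * p + b * q + c * r = 0 ->
    n 0 0 * a + n 0 1 * b + eps^-1 * (theta x n * c) = 0.
  move=> abc; have := nn (frame_vec x a b c).
  rewrite ip_heis_eps // !frame_vecE; apply; apply/cn.1.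
  by rewrite /covec !frame_vecE.
(* Testing on the kernel vectors [(q, -p, 0)], [(r, 0, -p)] and [(0, r, -q)] makes the 2 by 2 minors
   of the two covectors vanish. *)
have h1 : n 0 0 * q - n 0 1 * p = 0.
  by rewrite -(H q (- p) 0); [ring|ring].
have h2 : n 0 0 * r - eps^-1 * theta x n * p = 0.
  by rewrite -(H r 0 (- p)); [ring|ring].
have h3 : n 0 1 * r - eps^-1 * theta x n * q = 0.
  by rewrite -(H 0 r (- q)); [ring|ring].
(* The Euclidean projection coefficient onto [(p, q, r)]; each remaining difference is a combination
   of the vanishing minors. *)
exists ((n 0 0 * p + n 0 1 * q + eps^-1 * theta x n * r)
        / (p ^+ 2 + q ^+ 2 + r ^+ 2)).
have D0' := lt0r_neq0 D0; have e0' := lt0r_neq0 e0.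
set D := p ^+ 2 + q ^+ 2 + r ^+ 2 in D0 D0' *.
split; apply/eqP; rewrite -subr_eq0; apply/eqP.
- transitivity ((q * (n 0 0 * q - n 0 1 * p) +
    r * (n 0 0 * r - eps^-1 * theta x n * p)) / D).
    by rewrite /D; field; rewrite e0' -/D D0'.
  by rewrite h1 h2 !mulr0 addr0 mul0r.
- transitivity ((- p * (n 0 0 * q - n 0 1 * p) +
    r * (n 0 1 * r - eps^-1 * theta x n * q)) / D).
    by rewrite /D; field; rewrite e0' -/D D0'.
  by rewrite h1 h3 !mulr0 addr0 mul0r.
- transitivity (- eps * (p * (n 0 0 * r - eps^-1 * theta x n * p) +
    q * (n 0 1 * r - eps^-1 * theta x n * q)) / D).
    by rewrite /D; field; rewrite e0' -/D D0'.
  by rewrite h3 h2 !mulr0 addr0 mulr0 mul0r.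
Qed.

End Conormal.

(** * The unit normal of the metric with parameter [eps], in terms of a conormal *)

Section UnitNormal.
Set Implicit Arguments.
Unset Strict Implicit.
Context {R : realType}.
Implicit Types (x y v w n : 'rV[R]_3) (S U : set 'rV[R]_3).
Implicit Types (N : 'rV[R]_3 -> 'rV[R]_3) (p q r eps : R).

(** The dual norm of the covector for the metric with parameter [eps]. At [eps = 0] it becomes the
    length of the horizontal part. *)
Definition conormal_len eps p q r : R :=
  Num.sqrt (p ^+ 2 + q ^+ 2 + eps * r ^+ 2).

(** The normalised covector with its index raised; the last component gains a factor [eps] because
    [XT] has squared length [1 / eps]. *)
Definition unit_conormal_vec eps x p q r : 'rV[R]_3 :=
  frame_vec x (p / conormal_len eps p q r) (q / conormal_len eps p q r)
    (eps * (r / conormal_len eps p q r)).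

Lemma frame_vec_eqP x v a b c : v 0 0 = a -> v 0 1 = b -> theta x v = c ->
  v = frame_vec x a b c.
Proof.
move=> va vb vc; apply: row3P; rewrite !frame_vecE //.
by rewrite -va -vb -vc /theta; ring.
Qed.

(** The factor is positive because the covector takes the value [k (p^2 + q^2 + r^2)] on [N x], and
    [is_conormal] makes this value positive. *)
Lemma heis_normal_conormal S N x p q r : is_conormal S N x p q r ->
  normal_vector heis_metric S x (N x) ->
  exists2 k, 0 < k &
    [/\ N x 0 0 = k * p, N x 0 1 = k * q & theta x (N x) = k * r].
Proof.
move=> cn; rewrite heis_metricE => /(normal_conormal ltr01 cn).
have D0 := conormal_sqr_gt0 ltr01 cn; rewrite mul1r in D0.
move=> [k [k0 k1 k2]]; rewrite mul1r in k2; exists k => //.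
rewrite -(pmulr_lgt0 _ D0); have [_] := cn.
by rewrite /covec k0 k1 k2; congr (_ < _); ring.
Qed.

Lemma conormal_len_gt0 S N x p q r eps : 0 < eps -> is_conormal S N x p q r ->
  0 < conormal_len eps p q r.
Proof. by move=> e0 cn; rewrite sqrtr_gt0; apply: conormal_sqr_gt0 cn. Qed.

Lemma conormal_len_sqr S N x p q r eps : 0 < eps -> is_conormal S N x p q r ->
  conormal_len eps p q r ^+ 2 = p ^+ 2 + q ^+ 2 + eps * r ^+ 2.
Proof. by move=> e0 cn; rewrite sqr_sqrtr // ltW //; apply: conormal_sqr_gt0 cn. Qed.

Lemma ip_conormal eps x p q r v : 0 < eps ->
  ip (heis_metric_eps eps) x (unit_conormal_vec eps x p q r) v =
  covec x p q r v / conormal_len eps p q r.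
Proof.
move=> e0; rewrite ip_heis_eps // !frame_vecE /covec.
rewrite -[eps * _ * _]mulrA mulKf ?gt_eqF //.
by ring.
Qed.

Lemma unit_conormal_vecP S N x p q r eps :
  0 < eps -> is_conormal S N x p q r ->
  normal_vector heis_metric S x (N x) ->
  unit_normal_set (heis_metric_eps eps) S N x (unit_conormal_vec eps x p q r).
Proof.
move=> e0 cn nN; have L0 := conormal_len_gt0 e0 cn.
have L2 := conormal_len_sqr e0 cn.
split=> [v /cn.1 cv||].
- by rewrite ip_conormal // cv mul0r.
- rewrite ip_conormal // /covec !frame_vecE.
  set L := conormal_len eps p q r in L0 L2 *.
  transitivity ((p ^+ 2 + q ^+ 2 + eps * r ^+ 2) / L ^+ 2); last first.
    by rewrite -L2 divff // expf_neq0 // gt_eqF.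
  by field; rewrite gt_eqF.
- have [k k0 [kp kq kr]] := heis_normal_conormal cn nN.
  rewrite ip_heis kp kq kr !frame_vecE.
  set L := conormal_len eps p q r in L0 L2 *.
  rewrite (_ : _ + _ = k * ((p ^+ 2 + q ^+ 2 + eps * r ^+ 2) / L)); last first.
    by field; rewrite gt_eqF.
  by rewrite -L2 mulr_gt0 // divr_gt0 // exprn_gt0.
Qed.

(** Uniqueness: a normal is [k] times the raised covector, unit length gives [k^2 L^2 = 1] with [L]
    the dual norm, and lying on the side of [N] gives [k > 0]. *)
Lemma unit_normalE S N x p q r eps :
  0 < eps -> is_conormal S N x p q r ->
  normal_vector heis_metric S x (N x) ->
  unit_normal (heis_metric_eps eps) S N x = unit_conormal_vec eps x p q r.
Proof.
move=> e0 cn nN; apply: xget_subset1; first exact: unit_conormal_vecP.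
suff H n : unit_normal_set (heis_metric_eps eps) S N x n ->
    n = unit_conormal_vec eps x p q r by move=> a b /H -> /H ->.
move=> [nn n1 np]; have [k [k0 k1 k2]] := normal_conormal e0 cn nn.
have L0 := conormal_len_gt0 e0 cn; have L2 := conormal_len_sqr e0 cn.
have [k' k'0 [kp kq kr]] := heis_normal_conormal cn nN.
have e1 : k ^+ 2 * conormal_len eps p q r ^+ 2 = 1.
  rewrite -n1 ip_heis_eps // k0 k1 k2 L2; field; by rewrite gt_eqF.
have kk : 0 < k.
  move: np; rewrite ip_heis k0 k1 k2 kp kq kr.
  rewrite (_ : _ + _ = k * (k' * conormal_len eps p q r ^+ 2)).
    by rewrite pmulr_lgt0 // mulr_gt0 // exprn_gt0.
  by rewrite L2; ring.
have {e1} kL : k = (conormal_len eps p q r)^-1.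
  have : k * conormal_len eps p q r = 1.
    apply/eqP; rewrite -(@pexpr_eq1 _ _ 2) ?exprMn ?e1 //.
    by rewrite mulr_ge0 // ltW.
  by move/(canRL (mulfK (lt0r_neq0 L0))); rewrite mul1r.
by apply: frame_vec_eqP; rewrite ?k0 ?k1 ?k2 kL [_^-1 * _]mulrC.
Qed.

End UnitNormal.

(** * Derivatives of frame fields and the surface divergence *)

Section FrameFields.
Set Implicit Arguments.
Unset Strict Implicit.
Context {R : realType}.
Implicit Types (x v w : 'rV[R]_3) (S : set 'rV[R]_3) (eps : R).
Implicit Types (a b c : 'rV[R]_3 -> R) (Y : 'rV[R]_3 -> 'rV[R]_3).

(** The term [dtheta] comes from the frame itself: along [v], the last coordinates of [X1] and [X2]
    have derivatives [- v 0 1 / 2] and [v 0 0 / 2]. *)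
Lemma is_derive_frame_field a b c x v :
  differentiable a x -> differentiable b x -> differentiable c x ->
  forall i, is_derive x v (fun y => frame_vec y (a y) (b y) (c y) 0 i)
    (frame_vec x ('D_v a x) ('D_v b x)
      ('D_v c x - dtheta v (frame_vec x (a x) (b x) (c x))) 0 i).
Proof.
move=> da db dc.
have Da := derivableP (diff_derivable (v := v) da).
have Db := derivableP (diff_derivable (v := v) db).
have Dc := derivableP (diff_derivable (v := v) dc).
have d0 := is_derive_coord x v 0; have d1 := is_derive_coord x v 1.
apply: ord3P; under eq_fun => y do rewrite !frame_vecE; rewrite !frame_vecE //.
apply: is_derive_eq; rewrite /GRing.scale /= /dtheta !frame_vecE; by field.
Qed.

Lemma differentiable_frame_field a b c x :
  differentiable a x -> differentiable b x -> differentiable c x ->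
  forall i, differentiable (fun y => frame_vec y (a y) (b y) (c y) 0 i) x.
Proof.
move=> da db dc.
have dx i : differentiable (fun y : 'rV[R]_3 => y 0 i) x.
  exact: differentiable_coord.
apply: ord3P; under eq_fun => y do rewrite !frame_vecE //; try by [].
apply: differentiableD; last by do 2?apply: differentiableM.
by apply: differentiableB => //; do 2?apply: differentiableM.
Qed.

Lemma derive_along_frame_field S Y a b c x v :
  differentiable a x -> differentiable b x -> differentiable c x ->
  (\forall y \near x, S y -> Y y = frame_vec y (a y) (b y) (c y)) ->
  tangent S x v ->
  derive_along S Y x v = frame_vec x ('D_v a x) ('D_v b x)
    ('D_v c x - dtheta v (frame_vec x (a x) (b x) (c x))).
Proof.
move=> da db dc YZ tv; rewrite (derive_alongE YZ _ tv).
  by apply/rowP => i; rewrite mxE; have [_ ->] := is_derive_frame_field v da db dc i.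
exact: differentiable_frame_field.
Qed.

Lemma bilinear_rows n (C : 'M[R]_3) (B : 'M[R]_(n, 3)) i j :
  (B *m C *m B^T) i j = (row i B *m C *m (row j B)^T) 0 0.
Proof.
have E (M : 'M[R]_n) : (delta_mx 0 i *m M *m delta_mx j 0 : 'M[R]_1) 0 0 = M i j.
  by rewrite -rowE -colE !mxE.
by rewrite !rowE trmx_mul trmx_delta -E !mulmxA.
Qed.

(** Raising the index of [theta] gives [eps XT]. *)
Lemma invmx_theta eps x : 0 < eps ->
  invmx (heis_metric_eps eps x) *m (\col_i theta x (delta_mx 0 i)) =
  eps *: delta_mx 2 0.
Proof.
move=> e0; rewrite -[RHS](mulKmx (heis_eps_unit x e0)); congr (_ *m _).
apply/colP => i; rewrite -scalemxAr -colE [LHS]mxE [RHS]mxE [col _ _ _ _]mxE.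
rewrite heis_eps_gram //.
have -> : theta x (delta_mx 0 2) = 1 by rewrite delta3E /theta !vec3E; ring.
have -> : (i == 2) && (i != 2) = false by case: (i == 2).
by rewrite add0r mulr1 mulVKf // gt_eqF.
Qed.

Lemma mxtrace_rank1 n (k : R) (u : 'cV[R]_n) (w : 'rV[R]_n) (M : 'M[R]_n) :
  \tr (k *: (u *m w) *m M) = k * (w *m (M *m u)) 0 0.
Proof.
rewrite -scalemxAl mxtraceZ -mulmxA mxtrace_mulC -mulmxA.
by rewrite /mxtrace big_ord1.
Qed.

Lemma mxtrace_rows (C B : 'M[R]_3) : \tr (B *m C *m B^T) =
  (row 0 B *m C *m (row 0 B)^T) 0 0 + (row 1 B *m C *m (row 1 B)^T) 0 0 +
  (row 2 B *m C *m (row 2 B)^T) 0 0.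
Proof. by rewrite /mxtrace sum_ord3; do 2?congr (_ + _); exact: bilinear_rows. Qed.

(** The right-hand side is [X1 a + X2 b + XT c]. The last hypothesis says that the squared length
    [a^2 + b^2 + c^2 / eps] of the extended field is stationary along [Y x], which removes the
    normal entry of the full trace. *)
Lemma surface_div_frame_field eps S Y a b c x : 0 < eps -> S x ->
  differentiable a x -> differentiable b x -> differentiable c x ->
  (\forall y \near x, S y -> Y y = frame_vec y (a y) (b y) (c y)) ->
  tangent_onb (heis_metric_eps eps) S x !=set0 ->
  normal_vector (heis_metric_eps eps) S x (Y x) ->
  ip (heis_metric_eps eps) x (Y x) (Y x) = 1 ->
  a x * 'D_(Y x) a x + b x * 'D_(Y x) b x + eps^-1 * (c x * 'D_(Y x) c x) = 0 ->
  surface_div (heis_metric_eps eps) S Y x =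
    'D_(delta_mx 0 0) a x + 'D_(delta_mx 0 1) b x + 'D_(delta_mx 0 2) c x
    - x 0 1 / 2 * 'D_(delta_mx 0 2) a x + x 0 0 / 2 * 'D_(delta_mx 0 2) b x.
Proof.
move=> e0 Sx da db dc YZ onb nY Y1 dY.
have YxE : Y x = frame_vec x (a x) (b x) (c x) by exact: (nbhs_singleton YZ).
rewrite /surface_div; have [t1 t2 n11 n22 n12] := xgetPex (0, 0) onb.
set b1 := (xget _ _).1 in t1 n11 n12 *; set b2 := (xget _ _).2 in t2 n22 n12 *.
set G := heis_metric_eps eps in nY Y1 n11 n22 n12 *.
pose Z i y := frame_vec y (a y) (b y) (c y) 0 i.
pose A : 'M[R]_3 := \matrix_(i, j) 'D_(delta_mx 0 i) (Z j) x.
pose DZ v := frame_vec x ('D_v a x) ('D_v b x)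
    ('D_v c x - dtheta v (frame_vec x (a x) (b x) (c x))).
have AE v : v *m A = DZ v.
  apply/rowP => j; have [_ <-] := is_derive_frame_field v da db dc j.
  rewrite derive_coords; last exact: differentiable_frame_field.
  by rewrite mxE sum_ord3 !mxE.
(* [C] represents the quadratic form sending [v] to the product of [nabla_v Y] with [v]. On the
   diagonal the Christoffel term keeps only [theta v * dtheta (Y, v)], a matrix of rank one. *)
pose C := A *m G x +
  eps^-1 *: ((\col_i theta x (delta_mx 0 i)) *m
             (\row_j dtheta (Y x) (delta_mx 0 j))).
have CE v : (v *m C *m v^T) 0 0 =
    ip G x (DZ v) v + eps^-1 * (theta x v * dtheta (Y x) v).
  rewrite /C mulmxDr mulmxDl mxE mulmxA AE; congr (_ + _).
  rewrite -scalemxAr -scalemxAl mxE; congr (_ * _).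
  rewrite (mulmxA v) -mulmxA mxE big_ord1; congr (_ * _).
    by rewrite mxE sum_ord3 !mxE !delta3E /theta !vec3E; ring.
  by rewrite mxE sum_ord3 !mxE !delta3E /dtheta !vec3E /=; ring.
have dvv v : dtheta v v = 0 by rewrite /dtheta; ring.
have nE v : tangent S x v -> ip G x (nabla G S Y x v) v = (v *m C *m v^T) 0 0.
  move=> tv; rewrite ip_nabla_heis_eps // (derive_along_frame_field _ _ _ YZ) //.
  by rewrite CE -/(DZ v) /heis_christoffel_lower dvv mulr0 add0r.
rewrite !nE //.
pose B : 'M[R]_3 := \matrix_(i < 3) [:: b1; b2; Y x]`_i.
have rowB : (row 0 B = b1) * (row 1 B = b2) * (row 2 B = Y x) by rewrite !rowK.
have ipC v w : ip G x v w = ip G x w v by rewrite !ip_heis_eps //; ring.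
have BGB : B *m G x *m B^T = 1%:M.
  apply/matrixP => i j; rewrite bilinear_rows [RHS]mxE -/(ip G x _ _).
  move: i j; apply: ord3P; apply: ord3P; rewrite !rowB //=.
  - by rewrite ipC nY.
  - by rewrite ipC.
  - by rewrite ipC nY.
  - by rewrite nY.
  - by rewrite nY.
have YCY : (Y x *m C *m (Y x)^T) 0 0 = 0.
  have E0 : Y x 0 0 = a x by rewrite YxE frame_vecE.
  have E1 : Y x 0 1 = b x by rewrite YxE frame_vecE.
  have E2 : theta x (Y x) = c x by rewrite YxE frame_vecE.
  rewrite CE dvv !mulr0 addr0 ip_heis_eps // E0 E1 E2 /DZ -YxE dvv subr0.
  by rewrite !frame_vecE -dY; ring.
have trC := sum_bilinear_onb C (heis_eps_unit x e0) BGB.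
rewrite mxtrace_rows !rowB YCY addr0 in trC; rewrite {}trC.
rewrite /C mulmxDl mxtraceD mulmxK ?heis_eps_unit //.
(* The rank-one part contributes a multiple of [dtheta (Y, XT)], which is 0, and the trace of the
   Jacobian [A] remains. *)
rewrite mxtrace_rank1 invmx_theta //.
have -> : ((\row_j dtheta (Y x) (delta_mx 0 j)) *m
    (eps *: delta_mx 2 0 : 'cV[R]_3)) 0 0 = 0.
  by rewrite mxE sum_ord3 !mxE !delta3E /dtheta !vec3E /=; ring.
rewrite mulr0 addr0 /mxtrace sum_ord3 !mxE.
have ZE i j : 'D_(delta_mx 0 i) (Z j) x = DZ (delta_mx 0 i) 0 j.
  by have [_ <-] := is_derive_frame_field (delta_mx 0 i) da db dc j.
have d2 w : dtheta (delta_mx 0 2) w = 0.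
  by rewrite delta3E /dtheta !vec3E; ring.
by rewrite !ZE /DZ !frame_vecE d2; ring.
Qed.
End FrameFields.

(** * Curvatures *)

Section Curvature.
Set Implicit Arguments.
Unset Strict Implicit.
Context {R : realType}.
Implicit Types (x v w : 'rV[R]_3) (S : set 'rV[R]_3) (eps : R).
Implicit Types (f p q r : 'rV[R]_3 -> R) (N : 'rV[R]_3 -> 'rV[R]_3).

Lemma differentiable_sqrt (Q : 'rV[R]_3 -> R) x : differentiable Q x -> 0 < Q x ->
  differentiable (fun y => Num.sqrt (Q y)) x.
Proof.
move=> dQ Q0; apply: (@differentiable_comp _ _ _ _ Q Num.sqrt) => //.
by apply/derivable1_diffP; have [] := is_derive1_sqrt Q0.
Qed.

Lemma derive_sqrt_comp (Q : 'rV[R]_3 -> R) x v : differentiable Q x -> 0 < Q x ->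
  'D_v (fun y => Num.sqrt (Q y)) x = 'D_v Q x / (2 * Num.sqrt (Q x)).
Proof.
move=> dQ Q0; have [/derivable1_diffP ds Es] := is_derive1_sqrt Q0.
have ds' h : 'd Num.sqrt (Q x) h = h / (2 * Num.sqrt (Q x)).
  by rewrite -Es deriveE // -[in LHS](mulr1 h) [LHS]linearZ.
rewrite !deriveE //; last exact: differentiable_sqrt.
rewrite -ds'; exact: (congr1 (@^~ v) (diff_comp dQ ds)).
Qed.

Lemma differentiable_sqr f x : differentiable f x ->
  differentiable (fun y => f y ^+ 2) x.
Proof. by move=> df; apply: (differentiableM df df). Qed.

Section Ratios.
Variables (p q r : 'rV[R]_3 -> R) (x : 'rV[R]_3).
Hypotheses (dp : differentiable p x) (dq : differentiable q x)
  (dr : differentiable r x).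

Let Q eps y := p y ^+ 2 + q y ^+ 2 + eps * r y ^+ 2.
Let L eps y := conormal_len eps (p y) (q y) (r y).

Lemma differentiable_conormal_ratio eps f : 0 < Q eps x -> differentiable f x ->
  differentiable (fun y => f y / L eps y) x.
Proof.
move=> Q0 df; apply: differentiableM => //; apply: differentiableV.
  apply: differentiable_sqrt => //; apply: differentiableD.
    by apply: differentiableD; exact: differentiable_sqr.
  by apply: differentiableM => //; exact: differentiable_sqr.
by rewrite gt_eqF // sqrtr_gt0.
Qed.

(** Only positivity of [Q] is asked, so [eps = 0] is covered at non-characteristic points and one
    formula serves both curvatures. *)
Lemma derive_conormal_ratio eps f v : 0 < Q eps x -> differentiable f x ->
  'D_v (fun y => f y / L eps y) x = 'D_v f x / L eps x -
    f x * (p x * 'D_v p x + q x * 'D_v q x + eps * (r x * 'D_v r x))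
    / L eps x ^+ 3.
Proof.
move=> Q0 df; have L0 : 0 < L eps x by rewrite sqrtr_gt0.
have dQ : differentiable (Q eps) x.
  apply: differentiableD; first by apply: differentiableD; exact: differentiable_sqr.
  by apply: differentiableM => //; exact: differentiable_sqr.
have Df := derivableP (diff_derivable (v := v) df).
have Dp := derivableP (diff_derivable (v := v) dp).
have Dq := derivableP (diff_derivable (v := v) dq).
have Dr := derivableP (diff_derivable (v := v) dr).
have DQ : 'D_v (Q eps) x =
    2 * (p x * 'D_v p x + q x * 'D_v q x + eps * (r x * 'D_v r x)).
  by apply: derive_val; apply: is_derive_eq; rewrite /GRing.scale /=; ring.
have dL := differentiable_sqrt dQ Q0.
rewrite deriveM; last 2 first.
- exact: diff_derivable.
- apply: diff_derivable; apply: differentiableV => //; exact: lt0r_neq0 L0.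
rewrite deriveV; last 2 first.
- exact: lt0r_neq0 L0.
- exact: diff_derivable.
have sE : Num.sqrt (Q eps x) = L eps x by [].
rewrite derive_sqrt_comp // DQ sE /GRing.scale /=.
by field; exact: lt0r_neq0 L0.
Qed.
End Ratios.

(** This ensures that [xget] in [surface_div] returns an actual basis and not its default
    [(0, 0)]. *)
Lemma tangent_onb_exists eps S (N : 'rV[R]_3 -> 'rV[R]_3) x (p q r : R) :
  0 < eps -> 0 < p ^+ 2 + q ^+ 2 -> is_conormal S N x p q r ->
  tangent_onb (heis_metric_eps eps) S x !=set0.
Proof.
move=> e0 pq cn; have L0 := conormal_len_gt0 e0 cn.
have L2 := conormal_len_sqr e0 cn.
set L := conormal_len eps p q r in L0 L2.
set l := Num.sqrt (p ^+ 2 + q ^+ 2); have l0 : 0 < l by rewrite sqrtr_gt0.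
have l2 : l ^+ 2 = p ^+ 2 + q ^+ 2 by rewrite sqr_sqrtr // ltW.
set s := Num.sqrt eps; have s0 : 0 < s by rewrite sqrtr_gt0.
have s2 : s ^+ 2 = eps by rewrite sqr_sqrtr // ltW.
have [L0' l0' s0'] : [/\ L != 0, l != 0 & s != 0] by rewrite !gt_eqF.
(* The unit horizontal tangent, then the normalised multiple of [(p r, q r, - l^2)], which the
   covector annihilates because [l^2 = p^2 + q^2]. *)
exists (frame_vec x (q / l) (- p / l) 0,
  frame_vec x (p * s * r / (l * L)) (q * s * r / (l * L)) (- s * l / L)).
split=> /=.
- by apply/cn.1; rewrite /covec !frame_vecE; ring.
- apply/cn.1; rewrite /covec !frame_vecE.
  transitivity (s * r * (p ^+ 2 + q ^+ 2 - l ^+ 2) / (l * L)).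
    by field; rewrite L0' l0'.
  by rewrite l2 subrr mulr0 mul0r.
- rewrite ip_heis_eps // !frame_vecE.
  transitivity ((p ^+ 2 + q ^+ 2) / l ^+ 2).
    by rewrite -s2; field; rewrite l0' s0'.
  by rewrite -l2 divff // expf_neq0.
- rewrite ip_heis_eps // !frame_vecE.
  transitivity (((p ^+ 2 + q ^+ 2) / l ^+ 2 * (s ^+ 2 * r ^+ 2) + l ^+ 2) / L ^+ 2).
    by rewrite -s2; field; rewrite L0' l0' s0'.
  by rewrite -l2 divff ?expf_neq0 // l2 s2 mul1r addrC -L2 divff // expf_neq0.
- rewrite ip_heis_eps // !frame_vecE.
  by rewrite -s2; field; rewrite L0' l0' s0'.
Qed.

Definition conormal_ratio eps p q r f (y : 'rV[R]_3) : R :=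
  f y / conormal_len eps (p y) (q y) (r y).

Lemma riem_mean_curvature_conormal eps S N x p q r :
  differentiable p x -> differentiable q x -> differentiable r x ->
  S x -> (forall y, S y -> normal_vector heis_metric S y (N y)) ->
  (\forall y \near x, S y -> is_conormal S N y (p y) (q y) (r y)) ->
  0 < p x ^+ 2 + q x ^+ 2 -> 0 < eps ->
  riem_mean_curvature eps S N x =
    'D_(delta_mx 0 0) (conormal_ratio eps p q r p) x +
    'D_(delta_mx 0 1) (conormal_ratio eps p q r q) x +
    eps * 'D_(delta_mx 0 2) (conormal_ratio eps p q r r) x -
    x 0 1 / 2 * 'D_(delta_mx 0 2) (conormal_ratio eps p q r p) x +
    x 0 0 / 2 * 'D_(delta_mx 0 2) (conormal_ratio eps p q r q) x.
Proof.
move=> dp dq dr Sx nN near_cn pq e0; have cn := nbhs_singleton near_cn Sx.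
have L0 := conormal_len_gt0 e0 cn; have L2 := conormal_len_sqr e0 cn.
have Q0 := conormal_sqr_gt0 e0 cn.
have dR f : differentiable f x -> differentiable (conormal_ratio eps p q r f) x.
  exact: differentiable_conormal_ratio.
have dRr := diff_derivable (v := _) (dR _ dr).
have UE y : is_conormal S N y (p y) (q y) (r y) -> S y ->
    unit_normal (heis_metric_eps eps) S N y = frame_vec y
     (conormal_ratio eps p q r p y) (conormal_ratio eps p q r q y)
     (eps * conormal_ratio eps p q r r y).
  by move=> cny Sy; rewrite (unit_normalE e0 cny (nN _ Sy)).
have [uN u1 _] := unit_conormal_vecP e0 cn (nN _ Sx).
rewrite -(unit_normalE e0 cn (nN _ Sx)) in uN u1.
rewrite /riem_mean_curvature (surface_div_frame_field e0 Sx (dR _ dp) (dR _ dq)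
  (c := fun y => eps * conormal_ratio eps p q r r y)) //.
- by rewrite deriveMl.
- by apply: differentiableM => //; exact: dR.
- by apply: filterS near_cn => y cny Sy; rewrite UE //; exact: cny.
- exact: tangent_onb_exists pq cn.
(* The coefficients are normalised on a whole neighbourhood and not only on [S], so their squared
   length is constant: the derivative contains the factor [L^2 - (p^2 + q^2 + eps r^2)]. *)
- set v := unit_normal _ _ _ _; rewrite deriveMl //.
  rewrite /conormal_ratio !derive_conormal_ratio //.
  set L := conormal_len _ _ _ _ in L0 L2 *.
  set K := p x * _ + _ + _.
  transitivity (K * (L ^+ 2 - (p x ^+ 2 + q x ^+ 2 + eps * r x ^+ 2)) / L ^+ 4).
    by rewrite /K; field; rewrite !gt_eqF.
  by rewrite L2 subrr mulr0 mul0r.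
Qed.

Lemma hpE N x : hp N x = N x 0 0.
Proof.
rewrite /hp ip_heis (_ : theta x (X1 x) = 0); last first.
  by rewrite /theta /X1 !vec3E; ring.
by rewrite /X1 !vec3E; ring.
Qed.

Lemma hqE N x : hq N x = N x 0 1.
Proof.
rewrite /hq ip_heis (_ : theta x (X2 x) = 0); last first.
  by rewrite /theta /X2 !vec3E; ring.
by rewrite /X2 !vec3E; ring.
Qed.

(** [N] is a positive multiple of the conormal in its horizontal components, so [hpbar] and [hqbar]
    are the ratios at [eps = 0]; these provide a differentiable extension of the horizontal tangent
    off [S]. *)
Lemma H_mean_curvature_conormal S N x p q r :
  differentiable p x -> differentiable q x -> differentiable r x ->
  S x -> (forall y, S y -> normal_vector heis_metric S y (N y)) ->
  (\forall y \near x, S y -> is_conormal S N y (p y) (q y) (r y)) ->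
  0 < p x ^+ 2 + q x ^+ 2 ->
  let e := horizontal_tangent N x in
  e = frame_vec x (conormal_ratio 0 p q r q x) (- conormal_ratio 0 p q r p x) 0 /\
  H_mean_curvature S N x =
    conormal_ratio 0 p q r q x * 'D_e (conormal_ratio 0 p q r p) x -
    conormal_ratio 0 p q r p x * 'D_e (conormal_ratio 0 p q r q) x.
Proof.
move=> dp dq dr Sx nN near_cn pq e; have cn := nbhs_singleton near_cn Sx.
have Q0 : 0 < p x ^+ 2 + q x ^+ 2 + 0 * r x ^+ 2 by rewrite mul0r addr0.
have dR f : differentiable f x -> differentiable (conormal_ratio 0 p q r f) x.
  exact: differentiable_conormal_ratio.
have barE y : is_conormal S N y (p y) (q y) (r y) -> S y ->
    hpbar N y = conormal_ratio 0 p q r p y /\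
    hqbar N y = conormal_ratio 0 p q r q y.
  move=> cny Sy; have [k k0 [kp kq _]] := heis_normal_conormal cny (nN _ Sy).
  have hWE : hW N y = k * conormal_len 0 (p y) (q y) (r y).
    rewrite /hW /conormal_len hpE hqE kp kq mul0r addr0 !exprMn -mulrDr.
    by rewrite sqrtrM ?sqr_ge0 // sqrtr_sqr gtr0_norm.
  rewrite /hpbar /hqbar hpE hqE hWE kp kq /conormal_ratio.
  by rewrite -!mulf_div divff ?gt_eqF // !mul1r.
have eE y : is_conormal S N y (p y) (q y) (r y) -> S y ->
    horizontal_tangent N y = frame_vec y
     (conormal_ratio 0 p q r q y) (- conormal_ratio 0 p q r p y) 0.
  move=> cny Sy; have [hp hq] := barE _ cny Sy.
  rewrite /horizontal_tangent hp hq.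
  by apply: frame_vec_eqP; rewrite /theta !mxE /X1 /X2 ?vec3E /=; ring.
have exE : e = _ := eE _ cn Sx; split => //.
have te : tangent S x e.
  apply/cn.1; rewrite exE /covec !frame_vecE /conormal_ratio; ring.
have [hpx hqx] := barE _ cn Sx.
have nuE : horizontal_normal N x = frame_vec x
     (conormal_ratio 0 p q r p x) (conormal_ratio 0 p q r q x) 0.
  rewrite /horizontal_normal hpx hqx.
  by apply: frame_vec_eqP; rewrite /theta !mxE /X1 /X2 ?vec3E /=; ring.
rewrite /H_mean_curvature heis_metricE ip_nabla_heis_eps // -/e.
rewrite (derive_along_frame_field (dR _ dq)
  (b := fun y => - conormal_ratio 0 p q r p y) (c := cst 0) _ _ _ te) //.
- rewrite ip_heis_eps // nuE /heis_christoffel_lower !frame_vecE.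
  (* Both summands of the lowered symbol at [(e, e, nu)] contain [theta e], so the connection
     reduces to the coordinate derivative. *)
  have -> : theta x e = 0 by rewrite exE frame_vecE.
  rewrite deriveN; last exact/diff_derivable/dR.
  by ring.
- by apply: differentiableN; exact: dR.
- by apply: filterS near_cn => y cny Sy; rewrite eE //; exact: cny.
Qed.
End Curvature.

(* The summands with factor 0 are the terms that vanish with eps. *)
Lemma horizontal_curvature_identity (F : numFieldType)
    (p q r l x y p0 p1 p2 q0 q1 q2 r0 r1 r2 : F) :
  l != 0 -> l ^+ 2 = p ^+ 2 + q ^+ 2 ->
  p0 / l - p * (p * p0 + q * q0 + 0 * (r * r0)) / l ^+ 3 +
    (q1 / l - q * (p * p1 + q * q1 + 0 * (r * r1)) / l ^+ 3) +
    0 * (r2 / l - r * (p * p2 + q * q2 + 0 * (r * r2)) / l ^+ 3) -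
    y / 2 * (p2 / l - p * (p * p2 + q * q2 + 0 * (r * r2)) / l ^+ 3) +
    x / 2 * (q2 / l - q * (p * p2 + q * q2 + 0 * (r * r2)) / l ^+ 3) =
  (q * (q / l * p0 + - (p / l) * p1 +
        (0 - y / 2 * (q / l) + x / 2 * - (p / l)) * p2) -
   p * (q / l * q0 + - (p / l) * q1 +
        (0 - y / 2 * (q / l) + x / 2 * - (p / l)) * q2)) / l ^+ 2.
Proof.
move=> l0 l2; rewrite !mul0r !addr0; apply/eqP; rewrite -subr_eq0; apply/eqP.
transitivity ((p0 - y / 2 * p2 + q1 + x / 2 * q2) *
  (l ^+ 2 - (p ^+ 2 + q ^+ 2)) / l ^+ 3); first by field.
by rewrite l2 subrr mulr0 mul0r.
Qed.

(** * Passage to the limit at a non-characteristic point *)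

Theorem proposition9p13 (R : realType) (S : set 'rV[R]_3)
    (N : 'rV[R]_3 -> 'rV[R]_3) (hS : C2_surface S) (hN : orientation S N)
    (g0 : 'rV[R]_3) (hg0 : (S `\` characteristic_set S N) g0) :
  riem_mean_curvature eps S N g0 @[eps --> (0 : R)^'+]
    --> H_mean_curvature S N g0.
Proof.
have [Sx ncx] := hg0.
have [p [q [r [dp dq dr near_cn]]]] := local_conormal hS hN Sx.
have nN y : S y -> normal_vector heis_metric S y (N y).
  by move=> Sy; have [_ /(_ _ Sy)[]] := hN.
have cn := nbhs_singleton near_cn Sx.
have pq : 0 < p g0 ^+ 2 + q g0 ^+ 2.
  rewrite lt_neqAle addr_ge0 ?sqr_ge0 // andbT eq_sym.
  apply/eqP => pq0; apply: ncx; split => //.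
  have [k _ [kp kq _]] := heis_normal_conormal cn (nN _ Sx).
  by rewrite /hW hpE hqE kp kq !exprMn -mulrDr pq0 mulr0 sqrtr0.
pose len eps := conormal_len eps (p g0) (q g0) (r g0).
pose K eps v := p g0 * 'D_v p g0 + q g0 * 'D_v q g0 + eps * (r g0 * 'D_v r g0).
(* With all derivatives frozen at [g0], the curvature becomes an explicit function [H] of [eps],
   continuous from the right at 0 because [len 0] is nonzero. *)
pose ratio eps v (f : 'rV[R]_3 -> R) :=
  'D_v f g0 / len eps - f g0 * K eps v / len eps ^+ 3.
pose e i : 'rV[R]_3 := delta_mx 0 i.
pose H eps := ratio eps (e 0) p + ratio eps (e 1) q + eps * ratio eps (e 2) r
  - g0 0 1 / 2 * ratio eps (e 2) p + g0 0 0 / 2 * ratio eps (e 2) q.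
have Q0 eps : 0 <= eps -> 0 < p g0 ^+ 2 + q g0 ^+ 2 + eps * r g0 ^+ 2.
  by move=> e0; rewrite ltr_wpDr // mulr_ge0 ?sqr_ge0.
have ratioE eps v f : 0 <= eps -> differentiable f g0 ->
    'D_v (conormal_ratio eps p q r f) g0 = ratio eps v f.
  by move=> e0 df; rewrite /conormal_ratio derive_conormal_ratio // Q0.
(* The metric degenerates at [eps = 0] but [H] does not; agreement for [eps > 0] is enough for the
   right-hand limit. *)
have riemE : \forall eps \near (0 : R)^'+, H eps = riem_mean_curvature eps S N g0.
  near=> eps; have e0 : 0 < eps by near: eps; exact: nbhs_right_gt.
  by rewrite (riem_mean_curvature_conormal dp dq dr) // !ratioE // ltW.
have HE : H 0 = H_mean_curvature S N g0.
  have [eE ->] := H_mean_curvature_conormal dp dq dr Sx nN near_cn pq.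
  rewrite {}eE; set w := frame_vec _ _ _ _; rewrite !ratioE //.
  have l2 : len 0 ^+ 2 = p g0 ^+ 2 + q g0 ^+ 2.
    by rewrite sqr_sqrtr ?mul0r ?addr0 // ltW.
  have l0 : len 0 != 0 by rewrite gt_eqF // sqrtr_gt0 Q0.
  (* In [qbar D pbar - pbar D qbar] the terms that come from differentiating the length cancel. *)
  transitivity ((q g0 * 'D_w p g0 - p g0 * 'D_w q g0) / len 0 ^+ 2); last first.
    by rewrite /conormal_ratio -/(len 0) /ratio; field.
  rewrite !(derive_coords w) // !frame_vecE /conormal_ratio -/(len 0).
  exact: horizontal_curvature_identity.
rewrite -HE; apply: cvg_trans (near_eq_cvg riemE) _.
have ceps : eps @[eps --> (0 : R)^'+] --> (0 : R).
  by apply: cvg_at_right_filter; exact: cvg_id.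
have cQ : len eps @[eps --> (0 : R)^'+] --> len 0.
  have c2 : p g0 ^+ 2 + q g0 ^+ 2 + eps * r g0 ^+ 2 @[eps --> (0 : R)^'+] -->
      p g0 ^+ 2 + q g0 ^+ 2 + 0 * r g0 ^+ 2.
    apply: cvgD; first exact: cvg_cst.
    by apply: cvgM => //; exact: cvg_cst.
  exact: (cvg_comp _ _ c2 (@sqrt_continuous R _)).
have l0 : len 0 != 0 by rewrite gt_eqF // sqrtr_gt0 Q0.
have cV : (len eps)^-1 @[eps --> (0 : R)^'+] --> (len 0)^-1 by exact: cvgV.
have cV3 : (len eps ^+ 3)^-1 @[eps --> (0 : R)^'+] --> (len 0 ^+ 3)^-1.
  apply: cvgV; first by rewrite expf_neq0.
  by do 2?[apply: cvgM].
have cK v : K eps v @[eps --> (0 : R)^'+] --> K 0 v.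
  by apply: cvgD; [exact: cvg_cst | apply: cvgM => //; exact: cvg_cst].
have cr v f : ratio eps v f @[eps --> (0 : R)^'+] --> ratio 0 v f.
  apply: cvgB; first by apply: cvgM => //; exact: cvg_cst.
  by apply: cvgM => //; apply: cvgM => //; exact: cvg_cst.
apply: cvgD; last by apply: cvgM => //; exact: cvg_cst.
apply: cvgB; last by apply: cvgM => //; exact: cvg_cst.
apply: cvgD; last exact: cvgM.
by apply: cvgD.
Unshelve. all: by end_near.
Qed.
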